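(* Let $\{\mathfrak A_k\}_k$ be a multiplicative sequence of polynomial ideals and let $\mathfrak C$ be a closed ideal of operators. Then $\{\mathfrak A_k\circ\mathfrak C\}_k$ is a multiplicative sequence.
   Context: All Banach spaces are complex. $\mathcal P^k(E)$ is the Banach space of continuous $k$-homogeneous polynomials $E\to\mathbb C$; $\check P$ is the symmetric $k$-linear form of $P\in\mathcal P^k(E)$, and for $a\in E$, $P_a(x)=\check P(a,x,\dots,x)$. A Banach ideal of (scalar valued continuous) $k$-homogeneous polynomials is a pair $(\mathfrak A_k,\|\cdot\|_{\mathfrak A_k})$ such that: (i) for every Banach space $E$, $\mathfrak A_k(E)=\mathfrak A_k\cap\mathcal P^k(E)$ is a linear subspace of $\mathcal P^k(E)$ and $(\mathfrak A_k(E),\|\cdot\|_{\mathfrak A_k(E)})$ is a Banach space; (ii) if $T\in\mathcal L(E_1,E)$ and $P\in\mathfrak A_k(E)$ then $P\circ T\in\mathfrak A_k(E_1)$ and $\|P\circ T\|_{\mathfrak A_k(E_1)}\le\|P\|_{\mathfrak A_k(E)}\|T\|^k$; (iii) $z\mapsto z^k$ belongs to $\mathfrak A_k(\mathbb C)$ and has norm 1. A sequence $\{\mathfrak A_k\}_{k\ge1}$ of such ideals is coherent if there are constants $C,D>0$ such that for every Banach space $E$ and $k\in\mathbb N$: $P\in\mathfrak A_{k+1}(E)$, $a\in E$ imply $P_a\in\mathfrak A_k(E)$ and $\|P_a\|_{\mathfrak A_k(E)}\le C\|P\|_{\mathfrak A_{k+1}(E)}\|a\|$; and $P\in\mathfrak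 A_k(E)$, $\gamma\in E'$ imply $\gamma P\in\mathfrak A_{k+1}(E)$ and $\|\gamma P\|_{\mathfrak A_{k+1}(E)}\le D\|\gamma\|\|P\|_{\mathfrak A_k(E)}$. It is multiplicative if it is coherent and there is a constant $M$ such that for all $k,l$, every Banach space $E$, $P\in\mathfrak A_k(E)$, $Q\in\mathfrak A_l(E)$, one has $PQ\in\mathfrak A_{k+l}(E)$ and $\|PQ\|_{\mathfrak A_{k+l}(E)}\le M^{k+l}\|P\|_{\mathfrak A_k(E)}\|Q\|_{\mathfrak A_l(E)}$. A closed ideal of operators $\mathfrak C$ is a Banach operator ideal whose norm is the usual operator norm. The composition ideal $\mathfrak A_k\circ\mathfrak C$: $P\in\mathfrak A_k\circ\mathfrak C(E)$ iff $P=Q\circ T$ with $T\in\mathfrak C(E,E_1)$ and $Q\in\mathfrak A_k(E_1)$ for some Banach space $E_1$, with norm $\inf\|Q\|_{\mathfrak A_k(E_1)}\|T\|_{\mathfrak C(E,E_1)}^k$ over all such factorizations. *)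

(* Defs.v *)
(* MathComp-Analysis.  The scalar field is R[i] for an abstract R : realType. *)
From HB Require Import structures.
From mathcomp Require Import all_boot all_order all_fingroup all_algebra complex.
From mathcomp Require Import boolp classical_sets functions reals topology normedtype.
Set Implicit Arguments.
Unset Strict Implicit.
Unset Printing Implicit Defensive.
Import Order.TTheory GRing.Theory Num.Theory numFieldNormedType.Exports.
Local Open Scope classical_set_scope.
Local Open Scope ring_scope.
Local Open Scope complex_scope.

Lemma normc_ge_Im (R : realType) (z : R[i]) : `|complex.Im z|%:C <= `|z|.
Proof.
by rewrite normc_def lecR -sqrtr_sqr ler_wsqrtr // lerDr sqr_ge0.
Qed.

Lemma normc_le_ReIm (R : realType) (z : R[i]) :
  `|z| <= (`|complex.Re z| + `|complex.Im z|)%:C.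
Proof.
rewrite normc_def lecR -[leRHS]ger0_norm ?addr_ge0// -sqrtr_sqr.
rewrite ler_wsqrtr// sqrrD !real_normK ?num_real//.
by rewrite addrAC lerDl mulrn_wge0// mulr_ge0.
Qed.

Lemma C_complete (R : realType) (F : set_system (R[i])^o) :
  ProperFilter F -> cauchy F -> cvg F.
Proof.
move=> FF /cauchyP Fc.
have proj_cvg (f : {additive R[i] -> R}) :
    (forall z, `|f z|%:C <= `|z|) -> exists l : R, f x @[x --> F] --> l.
  move=> fle; apply/(@cvg_ex R)/(@R_complete R (f @ F)).
  apply/(cauchyP (f @ F)) => e e0.
  have [|x Fx] := Fc e%:C; first by rewrite ltcR.
  exists (f x); rewrite /nbhs/=; apply: filterS Fx => y.
  rewrite /preimage/= -!ball_normE/= => xye.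
  by rewrite -(raddfB f) -ltcR (le_lt_trans (fle _)).
have [a Fa] := proj_cvg (@complex.Re R) (@normc_ge_Re R).
have [b Fb] := proj_cvg (@complex.Im R) (@normc_ge_Im R).
apply/cvg_ex; exists (a +i* b); apply/cvgrPdist_lt => -[e e'].
rewrite ltcE/= => /andP[/eqP -> e0].
have e20 : 0 < e / 2 by rewrite divr_gt0.
move/cvgrPdist_lt : Fa => /(_ _ e20) Fa.
move/cvgrPdist_lt : Fb => /(_ _ e20) Fb.
near=> z; apply: (le_lt_trans (normc_le_ReIm _)).
rewrite -[ltRHS]/(e%:C) ltcR [e]splitr !raddfB/=.
by apply: ltrD; near: z.
Unshelve. all: by end_near. Qed.

HB.instance Definition _ (R : realType) := NormedModule.copy R[i] (R[i])^o.
HB.instance Definition _ (R : realType) :=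
  Uniform_isComplete.Build R[i] (@C_complete R).

Notation banach R := (completeNormedModType R[i]).

(* In a normedModType R[i] the norm `|x| is an element of R[i] (a nonnegative
   real one); rnorm x is the same number as an element of R. *)
Definition rnorm (R : realType) (E : normedModType R[i]) (x : E) : R :=
  complex.Re `|x|.

Lemma rnormE (R : realType) (E : normedModType R[i]) (x : E) :
  (rnorm x)%:C = `|x|.
Proof. by rewrite /rnorm RRe_real// normr_real. Qed.

(* S is a linear subspace of V and N restricted to S is a complete norm; the
   values of N outside S are irrelevant. *)
Record banach_subspace (R : realType) (V : lmodType R[i])
    (S : set V) (N : V -> R) : Prop := BanachSubspace {
  bsub0 : S 0;
  bsub_lin : forall (a : R[i]) (x y : V), S x -> S y -> S (a *: x + y);
  bsub_norm_ge0 : forall x : V, S x -> 0 <= N x;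
  bsub_norm_eq0 : forall x : V, S x -> N x = 0 -> x = 0;
  bsub_normZ : forall (a : R[i]) (x : V), S x -> N (a *: x) = rnorm a * N x;
  bsub_normD : forall x y : V, S x -> S y -> N (x + y) <= N x + N y;
  bsub_complete : forall u : nat -> V, (forall n, S (u n)) ->
    (forall e : R, 0 < e ->
       exists n0 : nat, forall m n : nat, (n0 <= m)%N -> (n0 <= n)%N ->
         N (u m - u n) < e) ->
    exists2 l : V, S l & forall e : R, 0 < e ->
      exists n0 : nat, forall n : nat, (n0 <= n)%N -> N (u n - l) < e
}.

Definition bounded_op (R : realType) (E F : banach R) : set (E -> F) :=
  [set T | linear T /\ continuous T].

Arguments bounded_op [R] E F _.

Definition opnorm (R : realType) (E F : banach R) (T : E -> F) : R :=
  sup [set rnorm (T x) | x in [set x : E | rnorm x <= 1]].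

Definition multilinear (R : realType) (E : banach R) (k : nat)
    (L : ('I_k -> E) -> R[i]) : Prop :=
  forall (v : 'I_k -> E) (i : 'I_k),
    scalar (fun x : E => L (fun j => if j == i then x else v j)).

Definition symmetric_form (R : realType) (E : banach R) (k : nat)
    (L : ('I_k -> E) -> R[i]) : Prop :=
  forall (s : 'S_k) (v : 'I_k -> E), L (v \o s) = L v.

Definition homog_poly (R : realType) (k : nat) (E : banach R) :
    set (E -> R[i]) :=
  [set P | continuous P /\
           exists2 L : ('I_k -> E) -> R[i],
             multilinear L & forall x, P x = L (fun=> x)].

Arguments homog_poly [R] k E _.

(* The symmetric k-linear form of P; for P in homog_poly k E exactly one form
   satisfies the three conditions (polarization). *)
Definition polar (R : realType) (k : nat) (E : banach R) (P : E -> R[i]) :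
    ('I_k -> E) -> R[i] :=
  xget (fun=> 0) [set L | [/\ multilinear L, symmetric_form L &
                             forall x, P x = L (fun=> x)]].

(* P_a, for P of degree k.+1. *)
Definition poly_at (R : realType) (k : nat) (E : banach R) (P : E -> R[i])
    (a : E) : E -> R[i] :=
  fun x => polar P (fun i : 'I_k.+1 => if i == ord0 then a else x).

Record poly_ideal (R : realType) := PolyIdeal {
  pi_set : forall E : banach R, set (E -> R[i]);
  pi_norm : forall E : banach R, (E -> R[i]) -> R
}.

Arguments pi_set [R] _ E _.
Arguments pi_norm [R] _ [E] _.

Record banach_poly_ideal (R : realType) (k : nat) (A : poly_ideal R) : Prop :=
    BanachPolyIdeal {
  bpi_poly : forall E : banach R, pi_set A E `<=` homog_poly k E;
  bpi_banach : forall E : banach R,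
    banach_subspace (pi_set A E) (@pi_norm R A E);
  bpi_comp : forall (E1 E : banach R) (T : E1 -> E) (P : E -> R[i]),
    bounded_op E1 E T -> pi_set A E P ->
    pi_set A E1 (P \o T) /\
    pi_norm A (P \o T) <= pi_norm A P * opnorm T ^+ k;
  bpi_one : pi_set A R[i] (fun z => z ^+ k) /\
            pi_norm A (fun z : R[i] => z ^+ k) = 1
}.

(* Sequences are indexed from 1: the 0-th term is irrelevant. *)
Definition coherent (R : realType) (A : nat -> poly_ideal R) : Prop :=
  (forall k : nat, (0 < k)%N -> banach_poly_ideal k (A k)) /\
  exists C D : R, [/\ 0 < C, 0 < D &
    forall (E : banach R) (k : nat), (0 < k)%N ->
      (forall (P : E -> R[i]) (a : E), pi_set (A k.+1) E P ->
         pi_set (A k) E (poly_at k P a) /\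
         pi_norm (A k) (poly_at k P a) <= C * pi_norm (A k.+1) P * rnorm a) /\
      (forall (P g : E -> R[i]), pi_set (A k) E P -> bounded_op E R[i] g ->
         pi_set (A k.+1) E (g * P) /\
         pi_norm (A k.+1) (g * P) <= D * opnorm g * pi_norm (A k) P)].

Definition multiplicative (R : realType) (A : nat -> poly_ideal R) : Prop :=
  coherent A /\
  exists M : R, forall (k l : nat), (0 < k)%N -> (0 < l)%N ->
    forall (E : banach R) (P Q : E -> R[i]),
      pi_set (A k) E P -> pi_set (A l) E Q ->
      pi_set (A (k + l)%N) E (P * Q) /\
      pi_norm (A (k + l)%N) (P * Q) <=
        M ^+ (k + l) * pi_norm (A k) P * pi_norm (A l) Q.

Record op_ideal (R : realType) := OpIdeal {
  oi_set : forall E F : banach R, set (E -> F);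
  oi_norm : forall E F : banach R, (E -> F) -> R
}.

Arguments oi_set [R] _ E F _.
Arguments oi_norm [R] _ [E F] _.

Record banach_op_ideal (R : realType) (C : op_ideal R) : Prop :=
    BanachOpIdeal {
  boi_op : forall E F : banach R, oi_set C E F `<=` bounded_op E F;
  boi_banach : forall E F : banach R,
    banach_subspace (oi_set C E F) (@oi_norm R C E F);
  boi_comp : forall (E0 E F F0 : banach R)
      (S : E0 -> E) (T : E -> F) (U : F -> F0),
    bounded_op E0 E S -> oi_set C E F T -> bounded_op F F0 U ->
    oi_set C E0 F0 (U \o T \o S) /\
    oi_norm C (U \o T \o S) <= opnorm U * oi_norm C T * opnorm S;
  boi_one : oi_set C R[i] R[i] id /\ oi_norm C (id : R[i] -> R[i]) = 1
}.

Definition closed_op_ideal (R : realType) (C : op_ideal R) : Prop :=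
  banach_op_ideal C /\
  forall (E F : banach R) (T : E -> F), oi_set C E F T ->
    oi_norm C T = opnorm T.

Definition comp_ideal (R : realType) (k : nat) (A : poly_ideal R)
    (C : op_ideal R) : poly_ideal R :=
  PolyIdeal
    (fun E => [set P | exists (E1 : banach R) (T : E -> E1) (Q : E1 -> R[i]),
       [/\ oi_set C E E1 T, pi_set A E1 Q & P = Q \o T]])
    (fun E P => inf [set r : R |
       exists (E1 : banach R) (T : E -> E1) (Q : E1 -> R[i]),
         [/\ oi_set C E E1 T, pi_set A E1 Q, P = Q \o T &
             r = pi_norm A Q * oi_norm C T ^+ k]]).

(* Main.v *)
From HB Require Import structures.
From mathcomp Require Import all_boot all_order all_fingroup all_algebra.
From mathcomp Require Import complex.
From mathcomp Require Import boolp classical_sets functions reals topology.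
From mathcomp Require Import normedtype.
From mathcomp Require Import ring lra.
Set Implicit Arguments.
Unset Strict Implicit.
Unset Printing Implicit Defensive.
Import Order.TTheory GRing.Theory Num.Theory numFieldNormedType.Exports.
Require Import Defs.
Local Open Scope classical_set_scope.
Local Open Scope ring_scope.
Local Open Scope complex_scope.

(** In a composition ideal, homogeneity moves the norm of the operator into the
polynomial: since the operator ideal carries the operator norm, the norm of P
is the infimum of the norms of Q over the factorizations P = Q o T with T in
the unit ball of the ideal (comp_factor). Two such factorizations P1 = Q1 o T1
and P2 = Q2 o T2 can be merged (comp_common_factor): the pair T = (T1, T2),
with values in the l_infinity sum of the two ranges, belongs to the operator
ideal and still has norm at most 1, while P1 and P2 become (Q1 o p1) o T and
(Q2 o p2) o T for the coordinate projections p1 and p2. Hence any bound for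
sums or products of polynomials in the given ideals passes, with the same
constant, to the composition ideals: this gives the triangle inequality
(comp_normD), multiplicativity, and the bound for products with a functional,
which is itself a polynomial of degree 1 (comp_product).

Completeness follows the same pattern with infinitely many factorizations
(comp_series): a rapidly convergent series of polynomials Q_j o T_j is rescaled
so that both the operators T_j and the polynomials Q_j are summable on the
l_infinity sum of the ranges, and its sum is the composition of the two sums.
The space of bounded families with the supremum norm is constructed for this
purpose.

For the polynomials P_a, the symmetric form of Q o T at (a, x, ..., x) is that
of Q at (T a, T x, ..., T x) (poly_at_comp), because the linear coefficient of
the polynomial t |-> P (x + t a) is k + 1 times the value of any symmetric form
of P at (a, x, ..., x) (symmetric_form_slot0). *)

(** * The real-valued norm and bounded operators *)

Section Rnorm.
Variables (R : realType) (E : normedModType R[i]).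
Implicit Types x y : E.

Lemma rnorm_ge0 x : 0 <= rnorm x.
Proof. by rewrite -lecR rnormE; exact: normr_ge0. Qed.

Lemma rnorm0 : rnorm (0 : E) = 0.
Proof. by rewrite /rnorm normr0. Qed.

Lemma rnorm_eq0 x : rnorm x = 0 -> x = 0.
Proof. by move=> x0; apply/eqP; rewrite -normr_eq0 -rnormE x0. Qed.

Lemma rnormZ (a : R[i]) x : rnorm (a *: x) = rnorm a * rnorm x.
Proof. by apply: complexI; rewrite rmorphM /= !rnormE normrZ. Qed.

Lemma rnormD x y : rnorm (x + y) <= rnorm x + rnorm y.
Proof. by rewrite -lecR rmorphD /= !rnormE ler_normD. Qed.

Lemma rnormN x : rnorm (- x) = rnorm x.
Proof. by rewrite /rnorm normrN. Qed.

Lemma rnormB x y : rnorm (x - y) = rnorm (y - x).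
Proof. by rewrite /rnorm distrC. Qed.

End Rnorm.

Section RnormScalar.
Variable R : realType.

Lemma rnormR (a : R) : rnorm (a%:C : R[i]) = `|a|.
Proof. by rewrite /rnorm normc_def /= expr0n addr0 sqrtr_sqr. Qed.

Lemma rnormM (a b : R[i]) : rnorm (a * b) = rnorm a * rnorm b.
Proof. by rewrite -rnormZ. Qed.

End RnormScalar.

Section Linear.
Variables (R : realType) (E F : lmodType R[i]) (T : E -> F).
Hypothesis linT : linear T.

Let Tl : {linear E -> F} :=
  HB.pack T (GRing.isLinear.Build R[i] E F *:%R T linT).

Lemma lin0 : T 0 = 0. Proof. exact: (linear0 Tl). Qed.
Lemma linZ a x : T (a *: x) = a *: T x. Proof. exact: (linearZZ Tl). Qed.

End Linear.

Section BoundedOp.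
Variable R : realType.
Implicit Types E F G : banach R.

Lemma bounded_opP E F (T : E -> F) :
  bounded_op E F T <->
  linear T /\ exists M : R, forall x, rnorm (T x) <= M * rnorm x.
Proof.
split=> -[linT]; pose Tl : {linear E -> F} :=
  HB.pack T (GRing.isLinear.Build R[i] E F *:%R T linT).
- move=> /(linear_bounded_continuous Tl)/linear_boundedP.
  case=> -[a b] [+ fr]; rewrite complex_real => /eqP b0.
  split=> //; exists (a + 1) => x.
  by rewrite -lecR rmorphM /= !rnormE; apply: fr; rewrite b0 ltcR ltrDl.
- case=> M TM; split=> //; apply/(linear_bounded_continuous Tl)/bounded_funP.
  move=> r; exists (`|M|%:C * r) => x xr; rewrite -!rnormE in xr *.
  apply: (@le_trans _ _ (`|M| * rnorm x)%:C).
    rewrite lecR (le_trans (TM x))// ler_wpM2r ?rnorm_ge0// ler_norm//.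
  by rewrite rmorphM /= ler_wpM2l// lecR.
Qed.

Section OneOp.
Variables (E F : banach R) (T : E -> F).
Hypothesis bT : bounded_op E F T.

Let linT : linear T. Proof. by case: bT. Qed.

Lemma opnorm_has_sup :
  has_sup [set rnorm (T x) | x in [set x : E | rnorm x <= 1]].
Proof.
split; first by exists (rnorm (T 0)), 0; rewrite //= rnorm0.
have [_ [M TM]] := (bounded_opP T).1 bT.
exists `|M| => _ [x /= x1 <-]; apply: (le_trans (TM x)).
apply: (le_trans (ler_norm _)); rewrite normrM (ger0_norm (rnorm_ge0 x)).
by rewrite ler_piMr.
Qed.

Lemma opnorm_ge0 : 0 <= opnorm T.
Proof.
apply: sup_upper_bound; first exact: opnorm_has_sup.
by exists 0; rewrite /= ?rnorm0// (lin0 linT) rnorm0.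
Qed.

Lemma le_opnorm x : rnorm (T x) <= opnorm T * rnorm x.
Proof.
have [x0|x_neq0] := eqVneq (rnorm x) 0.
  by rewrite (rnorm_eq0 x0) (lin0 linT) !rnorm0 mulr0.
have x_gt0 : 0 < rnorm x by rewrite lt_neqAle eq_sym x_neq0 rnorm_ge0.
rewrite -ler_pdivrMr// mulrC.
have -> : (rnorm x)^-1 * rnorm (T x) = rnorm (T ((rnorm x)^-1%:C *: x)).
  by rewrite (linZ linT) rnormZ rnormR ger0_norm// invr_ge0 ltW.
apply: sup_upper_bound; first exact: opnorm_has_sup.
exists ((rnorm x)^-1%:C *: x); last by [].
by rewrite /= rnormZ rnormR ger0_norm ?mulVf// invr_ge0 ltW.
Qed.

Lemma opnorm_le (M : R) : 0 <= M -> (forall x, rnorm (T x) <= M * rnorm x) ->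
  opnorm T <= M.
Proof.
move=> M0 TM; apply: ge_sup; first by case: opnorm_has_sup.
by move=> _ [x /= x1 <-]; rewrite (le_trans (TM x))// ler_piMr.
Qed.

End OneOp.

Lemma bounded_op_comp E F G (S : F -> G) (T : E -> F) :
  bounded_op F G S -> bounded_op E F T -> bounded_op E G (S \o T).
Proof.
move=> [lS cS] [lT cT]; split; first by move=> a x y /=; rewrite lT lS.
by move=> x; apply: continuous_comp; [exact: cT|exact: cS].
Qed.

Lemma bounded_op_id E : bounded_op E E id.
Proof. by split=> [a x y|x]; [|exact: cvg_id]. Qed.

Lemma opnorm_comp_le E F G (S : F -> G) (T : E -> F) :
  bounded_op F G S -> bounded_op E F T ->
  opnorm (S \o T) <= opnorm S * opnorm T.
Proof.
move=> bS bT; apply: opnorm_le; first exact: bounded_op_comp.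
  by rewrite mulr_ge0 ?opnorm_ge0.
move=> x /=; apply: (le_trans (le_opnorm bS _)).
by rewrite -mulrA ler_wpM2l ?opnorm_ge0 ?le_opnorm.
Qed.

End BoundedOp.

(** * The l_infinity sum of a sequence of Banach spaces *)

Section LinfVector.
Variables (R : realType) (E : nat -> banach R).

(** One construction indexed by nat serves twice: for the infinite sum in the
completeness proof and for pairs, where the components from index 2 on are
left at zero. *)
Record linf := Linf {
  coord :> forall i, E i;
  coord_bounded : exists M, forall i, rnorm (coord i) <= M
}.

Lemma linf_ext (f g : linf) : (forall i, f i = g i) -> f = g.
Proof.
case: f g => [f fb] [g gb] /= fg.
have {}fg : f = g by exact: functional_extensionality_dep.
by rewrite fg in fb *; congr Linf; exact: Prop_irrelevance.
Qed.

Lemma linf_zero_bounded : exists M, forall i, rnorm (0 : E i) <= M.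
Proof. by exists 0 => i; rewrite rnorm0. Qed.

Lemma linf_opp_bounded (f : linf) : exists M, forall i, rnorm (- f i) <= M.
Proof.
by case: (coord_bounded f) => M fM; exists M => i; rewrite rnormN.
Qed.

Lemma linf_add_bounded (f g : linf) :
  exists M, forall i, rnorm (f i + g i) <= M.
Proof.
case: (coord_bounded f) (coord_bounded g) => [M fM] [N gN].
by exists (M + N) => i; rewrite (le_trans (rnormD _ _))// lerD.
Qed.

Lemma linf_scale_bounded (a : R[i]) (f : linf) :
  exists M, forall i, rnorm (a *: f i) <= M.
Proof.
case: (coord_bounded f) => M fM; exists (rnorm a * M) => i.
by rewrite rnormZ ler_wpM2l ?rnorm_ge0.
Qed.

HB.instance Definition _ := gen_eqMixin linf.
HB.instance Definition _ := gen_choiceMixin linf.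

Let zero := Linf linf_zero_bounded.
Let opp f := Linf (linf_opp_bounded f).
Let add f g := Linf (linf_add_bounded f g).
Let scale a f := Linf (linf_scale_bounded a f).

Let addA : associative add.
Proof. by move=> f g h; apply: linf_ext => i /=; rewrite addrA. Qed.
Let addC : commutative add.
Proof. by move=> f g; apply: linf_ext => i /=; rewrite addrC. Qed.
Let add0 : left_id zero add.
Proof. by move=> f; apply: linf_ext => i /=; rewrite add0r. Qed.
Let addN : left_inverse zero opp add.
Proof. by move=> f; apply: linf_ext => i /=; rewrite addNr. Qed.

HB.instance Definition _ := GRing.isZmodule.Build linf addA addC add0 addN.

Let scaleA a b f : scale a (scale b f) = scale (a * b) f.
Proof. by apply: linf_ext => i /=; rewrite scalerA. Qed.
Let scale1 : left_id 1 scale.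
Proof. by move=> f; apply: linf_ext => i /=; rewrite scale1r. Qed.
Let scaleDr : right_distributive scale +%R.
Proof. by move=> a f g; apply: linf_ext => i /=; rewrite scalerDr. Qed.
Let scaleDl f : {morph scale^~ f : a b / a + b}.
Proof. by move=> a b; apply: linf_ext => i /=; rewrite scalerDl. Qed.

HB.instance Definition _ :=
  GRing.Zmodule_isLmodule.Build R[i] linf scaleA scale1 scaleDr scaleDl.

Lemma coordD (f g : linf) i : (f + g) i = f i + g i. Proof. by []. Qed.
Lemma coordZ a (f : linf) i : (a *: f) i = a *: f i. Proof. by []. Qed.

Definition linf_norm (f : linf) : R := sup (range (fun i => rnorm (f i))).

Lemma le_linf_norm (f : linf) i : rnorm (f i) <= linf_norm f.
Proof.
apply: sup_upper_bound; last by exists i.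
split; first by exists (rnorm (f 0)), 0.
by case: (coord_bounded f) => M fM; exists M => _ [j _ <-].
Qed.

Lemma linf_norm_le (f : linf) (M : R) :
  (forall i, rnorm (f i) <= M) -> linf_norm f <= M.
Proof.
move=> fM; apply: ge_sup; first by exists (rnorm (f 0)), 0.
by move=> _ [j _ <-].
Qed.

Let norm (f : linf) : R[i] := (linf_norm f)%:C.

Let normD f g : norm (f + g) <= norm f + norm g.
Proof.
rewrite /norm -rmorphD lecR; apply: linf_norm_le => i.
by rewrite (le_trans (rnormD _ _))// lerD ?le_linf_norm.
Qed.

Let normZ a f : norm (a *: f) = `|a| * norm f.
Proof.
rewrite /norm -[`|a|]rnormE -rmorphM; congr (_%:C); apply/eqP.
have norm_ge0 g : 0 <= linf_norm g.
  exact: (le_trans (rnorm_ge0 _) (le_linf_norm g 0)).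
have le b g : linf_norm (b *: g) <= rnorm b * linf_norm g.
  apply: linf_norm_le => i; rewrite coordZ rnormZ.
  by rewrite ler_wpM2l ?rnorm_ge0 ?le_linf_norm.
rewrite eq_le le /=; have [->|a0] := eqVneq a 0.
  by rewrite rnorm0 mul0r norm_ge0.
have := le a^-1 (a *: f); rewrite scalerA mulVf// scale1r => /ler_wpM2l.
move=> /(_ _ (rnorm_ge0 a)) /le_trans; apply.
by rewrite mulrA -rnormM divff// (rnormR 1) normr1 mul1r.
Qed.

Let norm_eq0 f : norm f = 0 -> f = 0.
Proof.
move=> [f0]; apply: linf_ext => i; apply: rnorm_eq0; apply/eqP.
by rewrite eq_le rnorm_ge0 -f0 le_linf_norm.
Qed.

HB.instance Definition _ :=
  Lmodule_isNormed.Build R[i] linf normD normZ norm_eq0.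

Lemma rnorm_linf (f : linf) : rnorm f = linf_norm f.
Proof. by []. Qed.

Lemma linf_norm_coord (f : linf) i : `|f i| <= `|f|.
Proof. by rewrite -!rnormE lecR rnorm_linf le_linf_norm. Qed.

(** A Cauchy filter converges in every coordinate. If it contains the ball of
radius e around x, then every coordinate of the limit is within 2e of that of
x, uniformly in the index; this bounds the limit and gives convergence in the
supremum norm. *)
Lemma linf_complete (F : set_system linf) :
  ProperFilter F -> cauchy F -> cvg F.
Proof.
move=> FF /cauchyP Fc.
have coord_cvg i : exists l : E i, (f : linf) i @[f --> F] --> l.
  suff : cauchy ((fun f : linf => f i) @ F).
    by move=> /cauchy_cvg/cvg_ex[z Fz]; exists z.
  apply/cauchyP => e e0; have [x Fx] := Fc e e0; exists (x i); rewrite /nbhs/=.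
  apply: filterS Fx => y; rewrite /preimage/= -!ball_normE/=.
  by apply: le_lt_trans; exact: (linf_norm_coord (x - y)).
pose l i := projT1 (cid (coord_cvg i)).
have lE i : (f : linf) i @[f --> F] --> l i := projT2 (cid (coord_cvg i)).
have l_near x e : 0 < e -> F (ball x e) ->
    forall i, `|l i - x i| <= e + e.
  move=> e0 Fx i.
  have /cvgrPdist_lt /(_ e e0) Fl := lE i.
  have [f [/= fl]] := filter_ex (filterI Fl Fx).
  rewrite -ball_normE /= => fx; rewrite -(subrKA (f i)).
  apply: (le_trans (ler_normD _ _)); rewrite lerD ?(ltW fl)//.
  rewrite -normrN opprB; apply: le_trans (ltW fx).
  exact: (linf_norm_coord (x - f)).
have lb : exists M, forall i, rnorm (l i) <= M.
  have [x Fx] := Fc 1 ltr01; have [M xM] := coord_bounded x.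
  exists (2 + M) => i; rewrite -[l i](subrK (x i)).
  apply: (le_trans (rnormD _ _)); rewrite lerD//.
  by rewrite -lecR rnormE (le_trans (l_near _ _ ltr01 Fx i))// rmorphD.
apply/cvg_ex; exists (Linf lb); apply/cvgrPdist_lt => e e0.
have e40 : 0 < e / 4 by rewrite divr_gt0.
have [x Fx] := Fc _ e40; apply: filterS (Fx) => f.
rewrite -ball_normE /= => xf.
have lx : `|Linf lb - x| <= e / 4 + e / 4.
  have ee : e / 4 + e / 4 = (complex.Re (e / 4 + e / 4))%:C.
    by rewrite RRe_real// gtr0_real// addr_gt0.
  rewrite -rnormE ee lecR rnorm_linf; apply: linf_norm_le => i.
  by rewrite -lecR rnormE -ee; exact: l_near.
rewrite -(subrKA x); apply: (le_lt_trans (ler_normD _ _)).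
apply: (lt_le_trans (ler_ltD lx xf)).
rewrite [leRHS](_ : e = e / 4 + e / 4 + e / 4 + e / 4); last by field.
by rewrite lerDl ltW.
Qed.

HB.instance Definition _ := Uniform_isComplete.Build linf linf_complete.

End LinfVector.

Section LinfOps.
Variables (R : realType) (E : nat -> banach R).
Local Notation F := (linf E : banach R).

Definition linf_proj i (f : linf E) : E i := f i.

Lemma linf_proj_bounded i : bounded_op F (E i) (@linf_proj i).
Proof.
apply/bounded_opP; split=> //; exists 1 => f.
by rewrite mul1r rnorm_linf le_linf_norm.
Qed.

Lemma opnorm_linf_proj i : opnorm (@linf_proj i : F -> E i) <= 1.
Proof.
apply: opnorm_le => // [|f]; first exact: linf_proj_bounded.
by rewrite mul1r rnorm_linf le_linf_norm.
Qed.

Lemma rnorm_dfwith i (x : E i) j :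
  rnorm (dfwith (fun i => 0 : E i) x j) <= rnorm x.
Proof. by case: dfwithP => // j' _; rewrite rnorm0 rnorm_ge0. Qed.

Definition linf_inj i (x : E i) : linf E :=
  Linf (ex_intro _ (rnorm x) (rnorm_dfwith x)).

Lemma linf_inj_in i (x : E i) : linf_inj x i = x.
Proof. exact: dfwith_in. Qed.

Lemma linf_inj_out i j (x : E i) : i != j -> linf_inj x j = 0.
Proof. exact: dfwith_out. Qed.

Lemma linf_inj_bounded i : bounded_op (E i) F (@linf_inj i).
Proof.
apply/bounded_opP; split; last first.
  exists 1 => x; rewrite mul1r rnorm_linf.
  by apply: linf_norm_le => j; exact: rnorm_dfwith.
move=> a x y; apply: linf_ext => j; rewrite coordD coordZ.
have [<-|ij] := eqVneq i j; first by rewrite !linf_inj_in.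
by rewrite !linf_inj_out// scaler0 addr0.
Qed.

Lemma opnorm_linf_inj i : opnorm (@linf_inj i : E i -> F) <= 1.
Proof.
apply: opnorm_le => // [|x]; first exact: linf_inj_bounded.
rewrite mul1r rnorm_linf; apply: linf_norm_le => j; exact: rnorm_dfwith.
Qed.

End LinfOps.

Lemma linf_inj_sum (R : realType) (D : nat -> banach R) (g : forall j, D j)
    n j :
  (\sum_(i < n) linf_inj (g i)) j = if (j < n)%N then g j else 0.
Proof.
elim: n => [|n IH]; first by rewrite big_ord0.
rewrite big_ord_recr coordD IH /= ltnS.
have [->|jn] := eqVneq j n; first by rewrite ltnn leqnn dfwith_in add0r.
by rewrite dfwith_out 1?eq_sym// addr0 ltn_neqAle jn.
Qed.

(** * Convergence in subspaces with a complete norm *)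

Lemma expr_half_small (R : realType) (e : R) : 0 < e ->
  exists n, 2^-1 ^+ n < e.
Proof.
move=> e0; exists (Num.bound e^-1); rewrite exprVn -[ltRHS]invrK.
rewrite ltf_pV2 ?posrE ?exprn_gt0 ?invr_gt0//.
apply: (lt_trans (archi_boundP _)); first by rewrite invr_ge0 ltW.
by rewrite -natrX ltr_nat ltn_expl.
Qed.

Section SubspaceSeries.
Variables (R : realType) (V : lmodType R[i]) (S : set V) (N : V -> R).

Definition converges_to (u : nat -> V) (l : V) : Prop :=
  forall e : R, 0 < e ->
    exists n0 : nat, forall n : nat, (n0 <= n)%N -> N (u n - l) < e.

Section Complete.
Hypothesis B : banach_subspace S N.

Lemma bsubZ a x : S x -> S (a *: x).
Proof.
by move=> Sx; rewrite -[_ *: _]addr0; exact: (bsub_lin B _ Sx (bsub0 B)).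
Qed.

Lemma bsubD x y : S x -> S y -> S (x + y).
Proof. by move=> Sx Sy; rewrite -[x]scale1r; exact: (bsub_lin B). Qed.

Lemma bsubB x y : S x -> S y -> S (x - y).
Proof.
by move=> Sx Sy; rewrite addrC -scaleN1r; exact: (bsub_lin B).
Qed.

Lemma bsub_sum (I : Type) (r : seq I) (D : I -> V) :
  (forall i, S (D i)) -> S (\sum_(i <- r) D i).
Proof.
by move=> SD; elim/big_ind: _ => //; [exact: (bsub0 B)|exact: bsubD].
Qed.

Lemma bsub_norm0 : N 0 = 0.
Proof.
by rewrite -[0 in LHS](scale0r 0) (bsub_normZ B _ (bsub0 B)) rnorm0 mul0r.
Qed.

Lemma bsub_normB x y : S x -> S y -> N (x - y) = N (y - x).
Proof.
move=> Sx Sy; rewrite -[x - y]opprB -[- (y - x)]scaleN1r.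
rewrite (bsub_normZ B _ (bsubB Sy Sx)).
by rewrite rnormN (rnormR 1) normr1 mul1r.
Qed.

(** Partial sums differ by at most the tail of a geometric series. *)
Lemma bsub_series (D : nat -> V) :
  (forall j, S (D j)) -> (forall j, N (D j) <= 2^-1 ^+ j) ->
  exists2 l, S l & converges_to (fun n => \sum_(j < n) D j) l.
Proof.
move=> SD ND; pose s n := \sum_(j < n) D j.
have Ss n : S (s n) by apply: bsub_sum => i; exact: SD.
apply: (bsub_complete B) => // e e0.
have tail m d : N (s (m + d)%N - s m) <= 2 * (2^-1 ^+ m - 2^-1 ^+ (m + d)).
  elim: d => [|d IH]; first by rewrite addn0 !subrr mulr0 bsub_norm0.
  rewrite addnS {1}/s big_ord_recr /= -/(s _) addrAC.
  apply: (le_trans (bsub_normD B (bsubB _ _) _)) => //.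
  apply: (le_trans (lerD IH (ND _))); rewrite exprS; lra.
have tail' m n : (m <= n)%N -> N (s n - s m) <= 2 * 2^-1 ^+ m.
  move=> mn; rewrite -(subnKC mn); apply: (le_trans (tail _ _)).
  by rewrite ler_pM2l// lerBlDr lerDl exprn_ge0 ?invr_ge0.
have [|n0 n0e] := @expr_half_small R (e / 4); first by rewrite divr_gt0.
exists n0 => m n n0m n0n; rewrite -/(s m) -/(s n) -(subrKA (s n0)).
apply: (le_lt_trans (bsub_normD B (bsubB _ _) (bsubB _ _))) => //.
rewrite (bsub_normB (Ss n0) (Ss n)).
apply: (le_lt_trans (lerD (tail' _ _ n0m) (tail' _ _ n0n))); lra.
Qed.

End Complete.

(** From a Cauchy sequence one extracts a subsequence whose n-th increment is
smaller than eps n, however fast eps decreases; the limit of the series of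
these increments gives the limit of the sequence. The rate eps is left free
so that it can be adapted to the degree of the polynomials. *)
Lemma complete_of_series (eps : nat -> R) :
  (forall x y, S x -> S y -> S (x + y)) ->
  (forall x y, S x -> S y -> S (x - y)) ->
  (forall x y, S x -> S y -> N (x + y) <= N x + N y) ->
  (forall j, 0 < eps j) ->
  (forall D, (forall j, S (D j)) -> (forall j, N (D j) < eps j) ->
    exists2 l, S l & converges_to (fun n => \sum_(j < n) D j) l) ->
  forall u : nat -> V, (forall n, S (u n)) ->
    (forall e : R, 0 < e ->
       exists n0 : nat, forall m n : nat, (n0 <= m)%N -> (n0 <= n)%N ->
         N (u m - u n) < e) ->
    exists2 l, S l & converges_to u l.
Proof.
move=> SD SB ND eps0 ser u Su uc.
pose phi j := projT1 (cid (uc _ (eps0 j))).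
have phiP j : forall m n, (phi j <= m)%N -> (phi j <= n)%N ->
  N (u m - u n) < eps j := projT2 (cid (uc _ (eps0 j))).
(* Summing the thresholds makes them increasing, with psi j >= j. *)
pose psi j := (\sum_(i < j.+1) (phi i).+1)%N.
have psiS j : psi j.+1 = (psi j + (phi j.+1).+1)%N.
  by rewrite /psi big_ord_recr.
have phi_psi j : (phi j <= psi j)%N.
  by rewrite /psi big_ord_recr /=; apply: leq_trans (leq_addl _ _).
have psi_ge j : (j <= psi j)%N.
  by elim: j => // j IH; rewrite psiS addnS ltnS (leq_trans IH)// leq_addr.
have [||l Sl lP] := ser (fun j => u (psi j.+1) - u (psi j)).
- by move=> j; exact: SB.
- move=> j; apply: phiP => //; rewrite psiS.
  by apply: (leq_trans (phi_psi j)); rewrite leq_addr.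
exists (l + u (psi 0)); first exact: SD.
move=> e e0; have e20 : 0 < e / 2 by rewrite divr_gt0.
have [n0 n0P] := lP _ e20; have [n1 n1P] := uc _ e20.
exists n1 => n n1n; pose J := maxn n0 n1.
have -> : u n - (l + u (psi 0)) =
    (u n - u (psi J)) + ((u (psi J) - u (psi 0)) - l).
  by rewrite [l + _]addrC opprD [in RHS]addrA subrKA addrA.
apply: (le_lt_trans (ND _ _ _ _)); [exact: SB|by apply: (SB) => //; exact: SB|].
rewrite [ltRHS]splitr ltrD//.
  by apply: n1P => //; exact: leq_trans (leq_maxr _ _) (psi_ge J).
have := n0P J (leq_maxl _ _).
rewrite -(big_mkord predT (fun j => u (psi j.+1) - u (psi j))).
by rewrite telescope_sumr.
Qed.

End SubspaceSeries.

(** * Homogeneous polynomials and their symmetric forms *)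

Section Multilinear.
Variables (R : realType) (E : banach R) (k : nat).
Implicit Types (L : ('I_k -> E) -> R[i]) (v w : 'I_k -> E).

Definition update v i x : 'I_k -> E := fun j => if j == i then x else v j.

Lemma multilinear_updateD L v i (a : R[i]) x y : multilinear L ->
  L (update v i (a *: x + y)) = a * L (update v i x) + L (update v i y).
Proof. by move=> Lm; exact: (Lm v i a x y). Qed.

Lemma multilinear_updateZ L v i (a : R[i]) x : multilinear L ->
  L (update v i (a *: x)) = a * L (update v i x).
Proof.
move=> Lm; have L0 : L (update v i 0) = 0.
  have := multilinear_updateD v i (-1) 0 0 Lm.
  by rewrite scaler0 addr0 mulN1r addNr.
by rewrite -[a *: x]addr0 multilinear_updateD// L0 addr0.
Qed.

(** The scalars are pulled out one slot at a time. *)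
Lemma multilinear_scale L (a : R[i]) v : multilinear L ->
  L (fun j => a *: v j) = a ^+ k * L v.
Proof.
move=> Lm; suff scale_first m : (m <= k)%N ->
    L (fun j => if (j < m)%N then a *: v j else v j) = a ^+ m * L v.
  rewrite -scale_first//; congr L; apply/funext => j; by rewrite ltn_ord.
elim: m => [_|m IH mk]; first by rewrite mul1r.
pose b : 'I_k -> E := fun j => if (j < m)%N then a *: v j else v j.
pose i0 := Ordinal mk.
have -> : (fun j : 'I_k => if (j < m.+1)%N then a *: v j else v j) =
    update b i0 (a *: v i0).
  apply/funext => j; rewrite /update /b ltnS leq_eqVlt -(inj_eq val_inj) /=.
  by have [jm|//] := eqVneq (j : nat) m; rewrite (_ : i0 = j)//; exact: val_inj.
rewrite multilinear_updateZ// exprS -mulrA -IH 1?ltnW//; congr (_ * L _).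
apply/funext => j; rewrite /update /b.
by case: eqVneq => // ->; rewrite ltnn.
Qed.

(** Along an affine line a multilinear form is a polynomial in the parameter;
its linear coefficient is the derivative of the form. *)
Lemma multilinear_line L v w : multilinear L ->
  exists p : {poly R[i]},
    (forall t, p.[t] = L (fun j => v j + t *: w j)) /\
    p`_1 = \sum_i L (update v i (w i)).
Proof.
move=> Lm; suff move_first m u : (m <= k)%N -> exists p : {poly R[i]},
    [/\ forall t,
          p.[t] = L (fun j => if (j < m)%N then u j + t *: w j else u j),
        p`_0 = L u & p`_1 = \sum_(i < k | (i < m)%N) L (update u i (w i))].
  have [p [pE _ p1]] := move_first k v (leqnn k); exists p; split.
    by move=> t; rewrite pE; congr L; apply/funext => j; rewrite ltn_ord.
  by rewrite p1; apply: eq_bigl => i; rewrite ltn_ord.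
elim: m u => [u _|m IH u mk].
  exists (L u)%:P; split=> [t||]; rewrite ?hornerC ?coefC//.
  by rewrite big_pred0.
pose i0 := Ordinal mk.
have [p [pE p0 p1]] := IH u (ltnW mk).
have [q [qE q0 q1]] := IH (update u i0 (w i0)) (ltnW mk).
exists (q * 'X + p); split=> [t||]; last 2 first.
- by rewrite coefD coefMX add0r.
- rewrite coefD coefMX q0 p1 [RHS](bigD1 i0) //=; congr (_ + _).
  by apply: eq_bigl => i; rewrite ltnS -(inj_eq val_inj) /= andbC -ltn_neqAle.
pose b : 'I_k -> E := fun j => if (j < m)%N then u j + t *: w j else u j.
have -> : (fun j : 'I_k => if (j < m.+1)%N then u j + t *: w j else u j) =
    update b i0 (t *: w i0 + u i0).
  apply/funext => j; rewrite /update /b ltnS leq_eqVlt -(inj_eq val_inj) /=.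
  have [jm|//] := eqVneq (j : nat) m; rewrite (_ : i0 = j) 1?addrC//.
  exact: val_inj.
rewrite multilinear_updateD// !hornerE pE qE mulrC; congr (_ * L _ + L _).
  apply/funext => j; rewrite /update /b.
  by case: eqVneq => // ->; rewrite ltnn.
apply/funext => j; rewrite /update /b.
by case: eqVneq => // ->; rewrite ltnn.
Qed.

Definition symmetrize L v : R[i] :=
  (k`!%:R)^-1 * \sum_(s : 'S_k) L (v \o s).

Lemma multilinear_symmetrize L : multilinear L -> multilinear (symmetrize L).
Proof.
move=> Lm v i a x y; rewrite /symmetrize mulrCA -mulrDr; congr (_ * _).
rewrite mulr_sumr -big_split /=; apply: eq_bigr => s _.
have upd z : (fun j => if j == i then z else v j) \o s =
    update (v \o s) ((s^-1)%g i) z.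
  by apply/funext => j; rewrite /update /= (canF_eq (permK s)).
by rewrite !upd multilinear_updateD.
Qed.

Lemma symmetric_symmetrize L : symmetric_form (symmetrize L).
Proof.
move=> t v; rewrite /symmetrize; congr (_ * _).
rewrite [RHS](reindex_inj (mulIg t)) /=; apply: eq_bigr => s _.
by congr L; apply/funext => j; rewrite /= permM.
Qed.

Lemma symmetrize_diag L x : symmetrize L (fun=> x) = L (fun=> x).
Proof.
rewrite /symmetrize (eq_bigr (fun=> L (fun=> x)))//.
rewrite sumr_const card_Sn -[L _ *+ _]mulr_natl mulKf//.
by rewrite pnatr_eq0 -lt0n fact_gt0.
Qed.

(** Averaging a multilinear form over the permutations of its slots makes it
symmetric without changing the polynomial, so the choice made by polar is
made in a nonempty set. *)
Lemma polarP (P : E -> R[i]) : homog_poly k E P ->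
  [/\ multilinear (polar (k := k) P), symmetric_form (polar (k := k) P) &
      forall x, P x = polar P (fun _ : 'I_k => x)].
Proof.
move=> [_ [L Lm PE]].
suff : exists L', [set L | [/\ multilinear L, symmetric_form L &
    forall x, P x = L (fun=> x)]] L' by move=> /(xgetPex (fun=> 0)).
exists (symmetrize L); split.
- exact: multilinear_symmetrize.
- exact: symmetric_symmetrize.
- by move=> x; rewrite symmetrize_diag.
Qed.

End Multilinear.

Lemma poly_eq0_of_values (R : realType) (p : {poly R[i]}) :
  (forall t, p.[t] = 0) -> p = 0.
Proof.
move=> p0; apply/eqP/negPn/negP => pn0.
pose rs : seq R[i] := [seq n%:R | n <- iota 0 (size p)].
have rs_root : all (root p) rs by apply/allP => t _; rewrite rootE p0.
have rs_uniq : uniq rs.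
  by rewrite map_inj_uniq ?iota_uniq//; exact: mulrIn (oner_neq0 _).
by have := max_poly_roots pn0 rs_root rs_uniq; rewrite size_map size_iota ltnn.
Qed.

(** The restriction to the diagonal determines the values of a symmetric form at
the points (a, x, ..., x): up to the factor k + 1, such a value is the
derivative at x in the direction a of the associated polynomial. *)
Lemma symmetric_form_slot0 (R : realType) (E : banach R) (k : nat)
    (L : ('I_k.+1 -> E) -> R[i]) :
  multilinear L -> symmetric_form L -> (forall x, L (fun=> x) = 0) ->
  forall a x, L (fun i => if i == ord0 then a else x) = 0.
Proof.
move=> Lm Ls L0 a x; pose v : 'I_k.+1 -> E := fun=> x.
have [p [pE p1]] := multilinear_line v (fun=> a) Lm.
have p0 : p = 0.
  by apply: poly_eq0_of_values => t; rewrite pE; exact: (L0 (x + t *: a)).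
have slot i : L (update v i a) = L (update v ord0 a).
  rewrite -(Ls (tperm ord0 i)); congr L; apply/funext => j.
  by rewrite /update /= (canF_eq (tpermK _ _)) tpermR.
move/esym: p1; rewrite p0 coef0 (eq_bigr _ (fun i _ => slot i)) sumr_const.
by rewrite card_ord => /eqP; rewrite mulrn_eq0 => /eqP.
Qed.

Section HomogPoly.
Variable R : realType.
Implicit Types E F : banach R.

Lemma homog_polyZ k E (P : E -> R[i]) a x : homog_poly k E P ->
  P (a *: x) = a ^+ k * P x.
Proof. by move=> [_ [L Lm PE]]; rewrite !PE multilinear_scale. Qed.

Lemma homog_poly_at0 k E (P : E -> R[i]) : (0 < k)%N -> homog_poly k E P ->
  P 0 = 0.
Proof.
move=> k0 Ph; rewrite -[0](scale0r 0) (homog_polyZ _ _ Ph).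
by rewrite expr0n eqn0Ngt k0 mul0r.
Qed.

Lemma multilinear_comp k E F (T : E -> F) (L : ('I_k -> F) -> R[i]) :
  linear T -> multilinear L -> multilinear (fun v => L (T \o v)).
Proof.
move=> lT Lm v i a x y.
have upd z : T \o (fun j => if j == i then z else v j) =
    update (T \o v) i (T z).
  by apply/funext => j; rewrite /update /=; case: ifP.
by rewrite (upd (a *: x + y)) (upd x) (upd y) lT multilinear_updateD.
Qed.

Lemma homog_poly_comp k E F (T : E -> F) (P : F -> R[i]) :
  bounded_op E F T -> homog_poly k F P -> homog_poly k E (P \o T).
Proof.
move=> [lT cT] [cP [L Lm PE]]; split.
  by move=> x; apply: continuous_comp; [exact: cT|exact: cP].
exists (fun v => L (T \o v)); first exact: multilinear_comp.
by move=> x /=; rewrite PE.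
Qed.

Lemma homog_poly1 E (P : E -> R[i]) : homog_poly 1 E P -> bounded_op E R[i] P.
Proof.
move=> [cP [L Lm PE]]; split=> // a x y.
have upd z : (fun=> z) = update (fun _ : 'I_1 => 0 : E) ord0 z.
  by apply/funext => j; rewrite /update ord1 eqxx.
by rewrite !PE (upd (a *: x + y)) (upd x) (upd y) multilinear_updateD.
Qed.

(** The polar form of P o T and the polar form of P composed with T are both
symmetric with diagonal P o T, so they agree in the slots that define P_a. *)
Lemma poly_at_comp k E F (T : E -> F) (P : F -> R[i]) a :
  bounded_op E F T -> homog_poly k.+1 F P ->
  poly_at k (P \o T) a = poly_at k P (T a) \o T.
Proof.
move=> bT Ph; have [lT _] := bT.
have [M1m M1s M1E] := polarP Ph.
have [M2m M2s M2E] := polarP (homog_poly_comp bT Ph).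
pose M v := - 1 * polar P (T \o v) + polar (k := k.+1) (P \o T) v.
apply/funext => x; apply/eqP; rewrite -subr_eq0; apply/eqP.
have -> : poly_at k (P \o T) a x - (poly_at k P (T a) \o T) x =
    M (fun i => if i == ord0 then a else x).
  rewrite /M mulN1r addrC; congr (- _ + _); congr polar.
  by apply/funext => j /=; case: ifP.
apply: symmetric_form_slot0 => [v i b y z|s v|y].
- rewrite /M (multilinear_comp lT M1m) M2m.
  rewrite mulrDr mulrDr mulrCA; exact: addrACA.
- by rewrite /M M2s compA M1s.
- by rewrite /M -M2E -[T \o _]/(fun=> T y) -M1E mulN1r addNr.
Qed.

End HomogPoly.

(** * Composition ideals *)

Lemma le_mul_of_gt (R : realType) (c x n : R) : 0 <= c ->
  (forall r, n < r -> x <= c * r) -> x <= c * n.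
Proof.
move=> c0 xr; apply/ler_addgt0Pr => e e0.
have c1 : 0 < c + 1 by rewrite ltr_wpDl.
have := xr (n + e / (c + 1)); rewrite ltrDl divr_gt0// => /(_ isT) /le_trans.
apply; rewrite mulrDr lerD2l mulrA ler_pdivrMr// mulrC ler_wpM2l ?ltW//.
by rewrite ltrDl.
Qed.

Lemma le_of_gt (R : realType) (x n : R) : (forall r, n < r -> x <= r) -> x <= n.
Proof.
move=> xr; rewrite -[n]mul1r; apply: le_mul_of_gt => // r.
by rewrite mul1r => /xr.
Qed.

Section PolyIdeal.
Variables (R : realType) (k : nat) (A : poly_ideal R).
Hypothesis hA : banach_poly_ideal k A.
Implicit Types E F : banach R.

Lemma pi_norm_ge0 E P : pi_set A E P -> 0 <= pi_norm A P.
Proof. exact: (bsub_norm_ge0 (bpi_banach hA E)). Qed.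

Lemma pi_comp E F (T : E -> F) P : bounded_op E F T -> pi_set A F P ->
  pi_set A E (P \o T).
Proof. by move=> bT AP; case: (bpi_comp hA bT AP). Qed.

Lemma pi_norm_comp E F (T : E -> F) P : bounded_op E F T -> pi_set A F P ->
  pi_norm A (P \o T) <= pi_norm A P * opnorm T ^+ k.
Proof. by move=> bT AP; case: (bpi_comp hA bT AP). Qed.

Lemma pi_norm_comp1 E F (T : E -> F) P : bounded_op E F T -> opnorm T <= 1 ->
  pi_set A F P -> pi_norm A (P \o T) <= pi_norm A P.
Proof.
move=> bT T1 AP; apply: (le_trans (pi_norm_comp bT AP)).
by rewrite ler_piMr ?pi_norm_ge0// exprn_ile1// opnorm_ge0.
Qed.

(** On the line through x the polynomial P is the multiple P x of the k-th
power, which has norm 1 in the ideal. *)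
Lemma pi_eval_le E P x : pi_set A E P ->
  rnorm (P x) <= pi_norm A P * rnorm x ^+ k.
Proof.
move=> AP; pose T (z : R[i]) : E := z *: x.
have bT : bounded_op R[i] E T.
  apply/bounded_opP; split; first by move=> a y z; rewrite /T scalerDl scalerA.
  by exists (rnorm x) => z; rewrite rnormZ mulrC.
have Tx : opnorm T <= rnorm x.
  by apply: opnorm_le; rewrite ?rnorm_ge0// => z; rewrite rnormZ mulrC.
have PT : P \o T = P x *: (fun z : R[i] => z ^+ k).
  apply/funext => z; rewrite /T /= (homog_polyZ _ _ (bpi_poly hA AP)) mulrC.
  by [].
have [one1 one2] := bpi_one hA.
have := pi_norm_comp bT AP.
rewrite PT (bsub_normZ (bpi_banach hA _))// one2 mulr1 => /le_trans; apply.
by rewrite ler_wpM2l ?pi_norm_ge0// lerXn2r ?nnegrE ?opnorm_ge0 ?rnorm_ge0.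
Qed.

End PolyIdeal.

Section ClosedOpIdeal.
Variables (R : realType) (C : op_ideal R).
Hypothesis hC : closed_op_ideal C.
Implicit Types E F G : banach R.

Lemma oi_bounded E F T : oi_set C E F T -> bounded_op E F T.
Proof. exact: (boi_op hC.1). Qed.

Lemma oi_banach E F : banach_subspace (oi_set C E F) (@oi_norm R C E F).
Proof. exact: (boi_banach hC.1). Qed.

Lemma oi_normE E F T : oi_set C E F T -> oi_norm C T = opnorm T.
Proof. exact: hC.2. Qed.

Lemma oi_compl E F G (U : F -> G) (T : E -> F) :
  bounded_op F G U -> oi_set C E F T -> oi_set C E G (U \o T).
Proof. by move=> bU CT; case: (boi_comp hC.1 (bounded_op_id E) CT bU). Qed.

Lemma oi_compr E F G (U : F -> G) (T : E -> F) :
  oi_set C F G U -> bounded_op E F T -> oi_set C E G (U \o T).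
Proof. by move=> CU bT; case: (boi_comp hC.1 bT CU (bounded_op_id G)). Qed.

Lemma oi_functional E g : bounded_op E R[i] g -> oi_set C E R[i] g.
Proof. by move=> bg; exact: (oi_compr (boi_one hC.1).1 bg). Qed.

(** The pair (T1, T2) is i1 o T1 + i2 o T2 for the injections i1, i2 into the
l_infinity sum, hence in the ideal; its norm in the ideal is the operator
norm, which for the supremum norm is the maximum of the two norms. *)
Lemma oi_pair E E1 E2 (T1 : E -> E1) (T2 : E -> E2) :
  oi_set C E E1 T1 -> opnorm T1 <= 1 -> oi_set C E E2 T2 -> opnorm T2 <= 1 ->
  exists (F : banach R) (T : E -> F) (p1 : F -> E1) (p2 : F -> E2),
    [/\ oi_set C E F T /\ opnorm T <= 1,
        bounded_op F E1 p1 /\ opnorm p1 <= 1,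
        bounded_op F E2 p2 /\ opnorm p2 <= 1,
        p1 \o T = T1 & p2 \o T = T2].
Proof.
move=> CT1 T11 CT2 T21.
(* Components of index 2 and more of the pair vanish. *)
pose D (n : nat) : banach R := if n is 0%N then E1 else E2.
pose T := ((@linf_inj _ D 0%N : E1 -> linf D) \o T1) +
          ((@linf_inj _ D 1%N : E2 -> linf D) \o T2).
have TE x n :
    T x n = linf_inj (T1 x : D 0%N) n + linf_inj (T2 x : D 1%N) n by [].
have T0 x : T x 0%N = T1 x.
  by rewrite TE linf_inj_in linf_inj_out// addr0.
have T1' x : T x 1%N = T2 x.
  by rewrite TE linf_inj_in linf_inj_out// add0r.
have Tge2 x n : T x n.+2 = 0.
  by rewrite TE !linf_inj_out// addr0.
have CT : oi_set C E (linf D) T.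
  apply: (bsubD (oi_banach _ _)); apply: oi_compl => //.
    exact: (@linf_inj_bounded _ D 0%N).
  exact: (@linf_inj_bounded _ D 1%N).
exists (linf D), T, (@linf_proj _ D 0%N), (@linf_proj _ D 1%N); split.
- split=> //; apply: opnorm_le => // [|x]; first exact: oi_bounded.
  rewrite mul1r rnorm_linf; apply: linf_norm_le => -[|[|n]].
  + rewrite T0; apply: (le_trans (le_opnorm (oi_bounded CT1) x)).
    by rewrite ler_piMl ?rnorm_ge0.
  + rewrite T1'; apply: (le_trans (le_opnorm (oi_bounded CT2) x)).
    by rewrite ler_piMl ?rnorm_ge0.
  + by rewrite Tge2 rnorm0 rnorm_ge0.
- split; first exact: (@linf_proj_bounded _ D 0%N).
  exact: (@opnorm_linf_proj _ D 0%N).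
- split; first exact: (@linf_proj_bounded _ D 1%N).
  exact: (@opnorm_linf_proj _ D 1%N).
- by apply/funext => x; exact: T0.
- by apply/funext => x; exact: T1'.
Qed.

Section CompIdealNorm.
Variables (k : nat) (A : poly_ideal R).
Hypotheses (k_gt0 : (0 < k)%N) (hA : banach_poly_ideal k A).
Local Notation B := (comp_ideal k A C).

Lemma comp_norm_lb E (P : E -> R[i]) (r : R) : [set r : R |
    exists (F : banach R) (T : E -> F) (Q : F -> R[i]),
      [/\ oi_set C E F T, pi_set A F Q, P = Q \o T &
          r = pi_norm A Q * oi_norm C T ^+ k]] r -> 0 <= r.
Proof.
move=> [F [T [Q [CT AQ _ ->]]]].
rewrite oi_normE// mulr_ge0 ?(pi_norm_ge0 hA)// exprn_ge0//.
by rewrite opnorm_ge0//; exact: oi_bounded.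
Qed.

Lemma comp_norm_le E F (T : E -> F) (Q : F -> R[i]) :
  oi_set C E F T -> pi_set A F Q ->
  pi_norm B (Q \o T) <= pi_norm A Q * opnorm T ^+ k.
Proof.
move=> CT AQ; apply: ge_inf; first by exists 0 => r; exact: comp_norm_lb.
by exists F, T, Q; split=> //; rewrite oi_normE.
Qed.

Lemma comp_norm_le1 E F (T : E -> F) (Q : F -> R[i]) :
  oi_set C E F T -> opnorm T <= 1 -> pi_set A F Q ->
  pi_norm B (Q \o T) <= pi_norm A Q.
Proof.
move=> CT T1 AQ; apply: (le_trans (comp_norm_le CT AQ)).
have T0 := opnorm_ge0 (oi_bounded CT).
by rewrite ler_piMr ?(pi_norm_ge0 hA)// exprn_ile1.
Qed.

Lemma comp_set E F (T : E -> F) (Q : F -> R[i]) :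
  oi_set C E F T -> pi_set A F Q -> pi_set B E (Q \o T).
Proof. by move=> CT AQ; exists F, T, Q. Qed.

Lemma comp_norm_ge0 E P : pi_set B E P -> 0 <= pi_norm B P.
Proof.
move=> [F [T [Q [CT AQ ->]]]]; apply: lb_le_inf; last exact: comp_norm_lb.
by exists (pi_norm A Q * oi_norm C T ^+ k), F, T, Q.
Qed.

(** By homogeneity the norm of the operator can be moved into the polynomial, so
that the norm of the composition ideal is the infimum of the norms of Q over
the factorizations P = Q o T with T in the unit ball. *)
Lemma comp_factor E P r : pi_set B E P -> pi_norm B P < r ->
  exists (F : banach R) (T : E -> F) (Q : F -> R[i]),
    [/\ oi_set C E F T, opnorm T <= 1, pi_set A F Q, pi_norm A Q < r &
        P = Q \o T].
Proof.
move=> BP Pr; have [F0 [T0 [Q0 [CT0 AQ0 P0]]]] := BP.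
have [|_ [F [T [Q [CT AQ PE ->]]]]] := inf_lt _ Pr.
  by exists (pi_norm A Q0 * oi_norm C T0 ^+ k), F0, T0, Q0.
rewrite oi_normE// => Qr; have bT := oi_bounded CT; have [lT _] := bT.
have SA := bpi_banach hA F; have SC := oi_banach E F.
(* If T = 0 then P = 0, since k > 0; the polynomial 0 is used instead of Q. *)
have [Tz|Tn0] := eqVneq (opnorm T) 0.
  exists F, T, 0; split=> //; first by rewrite Tz.
  - exact: bsub0 SA.
  - by rewrite (bsub_norm0 SA) (le_lt_trans (comp_norm_ge0 BP)).
  rewrite PE; apply/funext => x /=; have := le_opnorm bT x.
  rewrite Tz mul0r => Tx0; rewrite (rnorm_eq0 (x := T x)).
    exact: homog_poly_at0 (bpi_poly hA AQ).
  by apply/eqP; rewrite eq_le Tx0 rnorm_ge0.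
have T_gt0 : 0 < opnorm T by rewrite lt_neqAle eq_sym Tn0 opnorm_ge0.
exists F, ((opnorm T)^-1%:C *: T), ((opnorm T ^+ k)%:C *: Q); split.
- exact: (bsubZ SC).
- rewrite -oi_normE ?(bsub_normZ SC)// ?rnormR; last exact: (bsubZ SC).
  by rewrite oi_normE// ger0_norm ?invr_ge0 ?opnorm_ge0// mulVf.
- exact: (bsubZ SA).
- by rewrite (bsub_normZ SA)// rnormR ger0_norm ?exprn_ge0 ?ltW// mulrC.
rewrite PE; apply/funext => x; rewrite /= !fctE.
rewrite (homog_polyZ _ _ (bpi_poly hA AQ)) -[RHS]/(_ * (_ * _)) mulrA.
by rewrite -rmorphXn -rmorphM -exprMn divff// expr1n mul1r.
Qed.

End CompIdealNorm.

Arguments comp_set {k A E F T Q}.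

(** Pairing the two normalized operators does not increase their norm, and the
two polynomials, composed with the projections of the sum, keep their bounds.
Sums and products in the composition ideal are thus reduced to sums and
products on the range of a single operator. *)
Lemma comp_common_factor k l (A A' : poly_ideal R) E P1 P2 r1 r2 :
  (0 < k)%N -> (0 < l)%N -> banach_poly_ideal k A -> banach_poly_ideal l A' ->
  pi_set (comp_ideal k A C) E P1 -> pi_norm (comp_ideal k A C) P1 < r1 ->
  pi_set (comp_ideal l A' C) E P2 -> pi_norm (comp_ideal l A' C) P2 < r2 ->
  exists (F : banach R) (T : E -> F) (Q1 Q2 : F -> R[i]),
    [/\ oi_set C E F T /\ opnorm T <= 1,
        pi_set A F Q1 /\ pi_norm A Q1 < r1,
        pi_set A' F Q2 /\ pi_norm A' Q2 < r2,
        P1 = Q1 \o T & P2 = Q2 \o T].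
Proof.
move=> k0 l0 hA hA' BP1 Pr1 BP2 Pr2.
have [E1 [T1 [Q1 [CT1 T11 AQ1 Qr1 ->]]]] := comp_factor k0 hA BP1 Pr1.
have [E2 [T2 [Q2 [CT2 T21 AQ2 Qr2 ->]]]] := comp_factor l0 hA' BP2 Pr2.
have [F [T [p1 [p2 [CT [b1 p11] [b2 p21] <- <-]]]]] := oi_pair CT1 T11 CT2 T21.
exists F, T, (Q1 \o p1), (Q2 \o p2); split=> //.
- split; first exact: (pi_comp hA).
  exact: le_lt_trans (pi_norm_comp1 hA _ _ _) _.
- split; first exact: (pi_comp hA').
  exact: le_lt_trans (pi_norm_comp1 hA' _ _ _) _.
Qed.

(** * The composition ideal is a Banach ideal *)

Section CompBanach.
Variables (k : nat) (A : poly_ideal R).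
Hypotheses (k_gt0 : (0 < k)%N) (hA : banach_poly_ideal k A).
Local Notation B := (comp_ideal k A C).

Lemma comp_set_poly E : pi_set B E `<=` homog_poly k E.
Proof.
move=> _ [F [T [Q [CT AQ ->]]]].
by apply: homog_poly_comp; [exact: oi_bounded|exact: (bpi_poly hA)].
Qed.

Lemma comp_ideal_comp E F (T : E -> F) (P : F -> R[i]) :
  bounded_op E F T -> pi_set B F P ->
  pi_set B E (P \o T) /\ pi_norm B (P \o T) <= pi_norm B P * opnorm T ^+ k.
Proof.
move=> bT BP; split.
  have [G [S [Q [CS AQ ->]]]] := BP.
  by exists G, (S \o T), Q; split=> //; exact: oi_compr.
rewrite mulrC; apply: le_mul_of_gt => [|r Pr].
  by rewrite exprn_ge0// opnorm_ge0.
have [G [S [Q [CS S1 AQ Qr ->]]]] := comp_factor k_gt0 hA BP Pr.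
have bS := oi_bounded CS.
apply: (le_trans (comp_norm_le hA (oi_compr CS bT) AQ)).
have ST_ge0 := opnorm_ge0 (bounded_op_comp bS bT).
have T_ge0 := opnorm_ge0 bT.
rewrite mulrC; apply: ler_pM (ltW Qr).
- exact: exprn_ge0.
- exact: (pi_norm_ge0 hA).
rewrite lerXn2r ?nnegrE// (le_trans (opnorm_comp_le bS bT))//.
by rewrite ler_piMl.
Qed.

(** If z ^ k = Q o T with T of norm at most 1, the ideal property of A bounds
1 = norm (z ^ k) by the norm of Q. *)
Lemma comp_ideal_one :
  pi_set B R[i] (fun z => z ^+ k) /\ pi_norm B (fun z : R[i] => z ^+ k) = 1.
Proof.
have [A1 A1n] := bpi_one hA; have [C1 C1n] := boi_one hC.1.
have B1 : pi_set B R[i] (fun z => z ^+ k) by exact: (comp_set C1 A1).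
split=> //; apply/eqP; rewrite eq_le; apply/andP; split.
  rewrite -A1n; apply: (comp_norm_le1 hA C1) => //.
  by rewrite -(oi_normE C1) C1n.
apply: le_of_gt => r Pr.
have [F [T [Q [CT T1 AQ /ltW Qr PE]]]] := comp_factor k_gt0 hA B1 Pr.
apply: le_trans Qr; rewrite -A1n PE.
by apply: (pi_norm_comp1 hA) => //; exact: oi_bounded.
Qed.

(** This pointwise bound makes the seminorm of the composition ideal a norm. *)
Lemma comp_eval_le E P x : pi_set B E P ->
  rnorm (P x) <= pi_norm B P * rnorm x ^+ k.
Proof.
move=> BP; rewrite mulrC; apply: le_mul_of_gt => [|r Pr].
  by rewrite exprn_ge0// rnorm_ge0.
have [F [T [Q [CT T1 AQ Qr ->]]]] := comp_factor k_gt0 hA BP Pr.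
apply: (le_trans (pi_eval_le hA _ AQ)).
rewrite mulrC; apply: ler_pM (ltW Qr).
- by rewrite exprn_ge0 ?rnorm_ge0.
- exact: (pi_norm_ge0 hA).
rewrite lerXn2r ?nnegrE ?rnorm_ge0//.
apply: (le_trans (le_opnorm (oi_bounded CT) x)).
by rewrite ler_piMl ?rnorm_ge0.
Qed.

Lemma comp_set_lin E a P1 P2 : pi_set B E P1 -> pi_set B E P2 ->
  pi_set B E (a *: P1 + P2).
Proof.
move=> B1 B2.
have [F [T [Q1 [Q2 [[CT _] [AQ1 _] [AQ2 _] -> ->]]]]] :=
  comp_common_factor k_gt0 k_gt0 hA hA B1 (ltr_pwDr ltr01 (lexx _))
    B2 (ltr_pwDr ltr01 (lexx _)).
by apply: (comp_set CT (bsub_lin (bpi_banach hA F) a AQ1 AQ2)).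
Qed.

Lemma comp_normD E P1 P2 : pi_set B E P1 -> pi_set B E P2 ->
  pi_norm B (P1 + P2) <= pi_norm B P1 + pi_norm B P2.
Proof.
move=> B1 B2; rewrite -lerBlDr; apply: le_of_gt => r1 Pr1.
rewrite lerBlDr -lerBlDl; apply: le_of_gt => r2 Pr2.
have [F [T [Q1 [Q2 [[CT T1] [AQ1 Qr1] [AQ2 Qr2] -> ->]]]]] :=
  comp_common_factor k_gt0 k_gt0 hA hA B1 Pr1 B2 Pr2.
have SA := bpi_banach hA F.
rewrite lerBlDl.
apply: (le_trans (comp_norm_le1 hA CT T1 (bsubD SA AQ1 AQ2))).
by apply: (le_trans (bsub_normD SA AQ1 AQ2)); rewrite lerD ?ltW.
Qed.

Lemma comp_set0 E : pi_set B E 0.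
Proof.
exact: (comp_set (bsub0 (oi_banach E E)) (bsub0 (bpi_banach hA E))).
Qed.

Lemma comp_setZ E a P : pi_set B E P -> pi_set B E (a *: P).
Proof.
move=> BP; rewrite -[_ *: _]addr0; apply: comp_set_lin => //.
exact: comp_set0.
Qed.

Lemma comp_normZ E a P : pi_set B E P ->
  pi_norm B (a *: P) = rnorm a * pi_norm B P.
Proof.
have le b P' : pi_set B E P' -> pi_norm B (b *: P') <= rnorm b * pi_norm B P'.
  move=> BP; apply: le_mul_of_gt; [exact: rnorm_ge0|move=> r Pr].
  have [F [T [Q [CT T1 AQ Qr ->]]]] := comp_factor k_gt0 hA BP Pr.
  have SA := bpi_banach hA F.
  apply: (le_trans (comp_norm_le1 hA CT T1 (bsubZ SA b AQ))).
  by rewrite (bsub_normZ SA)// ler_wpM2l ?rnorm_ge0// ltW.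
move=> BP; apply/eqP; rewrite eq_le le//=; have [->|a0] := eqVneq a 0.
  by rewrite rnorm0 mul0r comp_norm_ge0//; exact: comp_setZ.
have := le a^-1 _ (comp_setZ a BP); rewrite scalerA mulVf// scale1r.
move=> /(ler_wpM2l (rnorm_ge0 a)) /le_trans; apply.
by rewrite mulrA -rnormM divff// (rnormR 1) normr1 mul1r.
Qed.

(** Write D_j = Q_j o T_j with T_j in the unit ball, and let F be the l_infinity
sum of the ranges of the T_j. With h = 2^-j, the operators h T_j have norm at
most h, so their images in F sum to an operator U of the closed ideal. By
homogeneity the polynomials are divided by h^k; the bound h^(k+1) leaves them
with norm at most h, so that, composed with the projections of F, they sum to
a polynomial W on F. Both partial sums are read through the same U, hence the
sum of the D_j is W o U, with remainder bounded by that of W. *)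
Lemma comp_series E (D : nat -> E -> R[i]) :
  (forall j, pi_set B E (D j)) ->
  (forall j, pi_norm B (D j) < (2^-1 ^+ j) ^+ k.+1) ->
  exists2 P, pi_set B E P &
    converges_to (@pi_norm R B E) (fun n => \sum_(j < n) D j) P.
Proof.
move=> BD ND; pose h j : R := 2^-1 ^+ j.
have h_gt0 j : 0 < h j by rewrite exprn_gt0// invr_gt0.
have fact j := comp_factor k_gt0 hA (BD j) (ND j).
pose F j : banach R := projT1 (cid (fact j)).
have factT j := projT2 (cid (fact j)).
pose T j : E -> F j := projT1 (cid (factT j)).
have factQ j := projT2 (cid (factT j)).
pose Q j : F j -> R[i] := projT1 (cid (factQ j)).
have TQ j :
  [/\ oi_set C E (F j) (T j), opnorm (T j) <= 1, pi_set A (F j) (Q j),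
      pi_norm A (Q j) < h j ^+ k.+1 & D j = Q j \o T j] :=
  projT2 (cid (factQ j)).
have CT j : oi_set C E (F j) ((h j)%:C *: T j).
  by apply: (bsubZ (oi_banach _ _)); case: (TQ j).
pose G : banach R := linf F.
pose inj j : E -> G := (@linf_inj _ F j : F j -> G) \o ((h j)%:C *: T j).
have Cinj j : oi_set C E G (inj j).
  by apply: oi_compl (CT j); exact: linf_inj_bounded.
have SC := oi_banach E G; have SA := bpi_banach hA G.
have [j|U CU Ulim] := bsub_series SC Cinj.
  rewrite oi_normE//; apply: (le_trans (opnorm_comp_le _ _)).
  - exact: linf_inj_bounded.
  - exact: oi_bounded.
  apply: (@le_trans _ _ (opnorm ((h j)%:C *: T j))).
    by rewrite ler_piMl ?opnorm_linf_inj// opnorm_ge0//; exact: oi_bounded.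
  have [CTj Tj1 _ _ _] := TQ j.
  rewrite -oi_normE// (bsub_normZ (oi_banach _ _))// rnormR gtr0_norm//.
  by rewrite oi_normE// ler_piMr// ltW.
(* Convergence in operator norm implies convergence of each coordinate, and the
   j-th coordinate of the partial sums is constant from index j + 1 on. *)
have UE x j : U x j = (h j)%:C *: T j x.
  apply/eqP; rewrite -subr_eq0; apply/eqP/rnorm_eq0/eqP.
  rewrite eq_le rnorm_ge0 andbT -[leRHS](mulr0 (rnorm x)).
  apply: le_mul_of_gt => [|e /Ulim[n0 n0P]]; first exact: rnorm_ge0.
  pose n := maxn n0 j.+1; have := n0P n (leq_maxl _ _).
  set V := \sum_(i < n) inj i => VU.
  have CV : oi_set C E G V by apply: (bsub_sum SC) => i; exact: Cinj.
  have bVU := oi_bounded (bsubB SC CV CU).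
  have VE : V x j = (h j)%:C *: T j x.
    rewrite /V fct_sumE; rewrite (linf_inj_sum (fun j => (h j)%:C *: T j x)).
    by rewrite leq_maxr.
  rewrite -VE rnormB mulrC.
  apply: (@le_trans _ _ (rnorm ((V - U) x))).
    by rewrite rnorm_linf; exact: (le_linf_norm (V x - U x)).
  apply: (le_trans (le_opnorm bVU x)); rewrite ler_wpM2r ?rnorm_ge0//.
  by rewrite -(oi_normE (bsubB SC CV CU)); exact: ltW VU.
pose q j : G -> R[i] := ((h j ^- k)%:C *: Q j) \o (@linf_proj _ F j).
have AQ j : pi_set A (F j) ((h j ^- k)%:C *: Q j).
  by apply: (bsubZ (bpi_banach hA _)); case: (TQ j).
have Aq j : pi_set A G (q j).
  by apply: (pi_comp hA) (AQ j); exact: linf_proj_bounded.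
have [j|W AW Wlim] := bsub_series SA Aq.
  apply: (le_trans (pi_norm_comp1 hA _ _ (AQ j))).
  - exact: linf_proj_bounded.
  - exact: opnorm_linf_proj.
  have [_ _ AQj /ltW Qj _] := TQ j.
  rewrite (bsub_normZ (bpi_banach hA _))// rnormR.
  have hk : 0 < h j ^+ k by exact: exprn_gt0.
  rewrite gtr0_norm ?invr_gt0// mulrC ler_pdivrMr//.
  by apply: (le_trans Qj); rewrite exprS.
have qU j : q j \o U = D j.
  have [_ _ AQj _ ->] := TQ j; apply/funext => x.
  rewrite /q /= /linf_proj UE !fctE -[LHS]/(_ * _).
  rewrite (homog_polyZ _ _ (bpi_poly hA AQj)) mulrA -rmorphXn -rmorphM.
  by rewrite mulVf ?mul1r// expf_neq0// gt_eqF.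
exists (W \o U); first exact: comp_set.
move=> e e0; pose c := opnorm U ^+ k.
have c1 : 0 < c + 1.
  by rewrite ltr_wpDl// exprn_ge0// opnorm_ge0//; exact: oi_bounded.
have [|n0 n0P] := Wlim (e / (c + 1)); first by rewrite divr_gt0.
exists n0 => n /n0P; set w := \sum_(j < n) q j => wW.
have Aw : pi_set A G w by apply: (bsub_sum SA) => i; exact: Aq.
have /= -> : \sum_(j < n) D j - (W \o U) = (w - W) \o U.
  apply/funext => x; rewrite /w /= !fctE !fct_sumE; congr (_ - _).
  by apply: eq_bigr => j _; rewrite -qU.
apply: (le_lt_trans (comp_norm_le hA CU (bsubB SA Aw AW))).
rewrite ltr_pdivlMr// in wW; apply: le_lt_trans wW.
by rewrite ler_wpM2l ?lerDl//; exact: (pi_norm_ge0 hA (bsubB SA Aw AW)).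
Qed.

Lemma banach_comp_ideal : banach_poly_ideal k B.
Proof.
split; [exact: comp_set_poly| |exact: comp_ideal_comp|exact: comp_ideal_one].
move=> E; split.
- exact: comp_set0.
- by move=> a P1 P2; exact: comp_set_lin.
- by move=> P; exact: comp_norm_ge0.
- move=> P BP P0; apply/funext => x; apply: rnorm_eq0; apply/eqP.
  rewrite eq_le rnorm_ge0 andbT.
  by apply: (le_trans (comp_eval_le x BP)); rewrite P0 mul0r.
- by move=> a P; exact: comp_normZ.
- exact: comp_normD.
- apply: (@complete_of_series _ _ _ _ (fun j => (2^-1 ^+ j) ^+ k.+1)).
  + move=> P1 P2 B1 B2; rewrite -[P1]scale1r; exact: comp_set_lin.
  + move=> P1 P2 B1 B2; rewrite addrC -scaleN1r; exact: comp_set_lin.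
  + exact: comp_normD.
  + by move=> j; rewrite !exprn_gt0// invr_gt0.
  + exact: comp_series.
Qed.

End CompBanach.

(** The polynomials of a common factorization are multiplied on its range. The
constant K stays free: it is a power of |M| for the multiplicativity of the
sequence, and the coherence constant when P1 is a functional. *)
Lemma comp_product k l (A A' A'' : poly_ideal R) E P1 P2 (K : R) :
  (0 < k)%N -> (0 < l)%N -> banach_poly_ideal k A -> banach_poly_ideal l A' ->
  banach_poly_ideal (k + l) A'' -> 0 <= K ->
  (forall (F : banach R) Q1 Q2, pi_set A F Q1 -> pi_set A' F Q2 ->
     pi_set A'' F (Q1 * Q2) /\
     pi_norm A'' (Q1 * Q2) <= K * pi_norm A Q1 * pi_norm A' Q2) ->
  pi_set (comp_ideal k A C) E P1 -> pi_set (comp_ideal l A' C) E P2 ->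
  pi_set (comp_ideal (k + l) A'' C) E (P1 * P2) /\
  pi_norm (comp_ideal (k + l) A'' C) (P1 * P2) <=
    K * pi_norm (comp_ideal k A C) P1 * pi_norm (comp_ideal l A' C) P2.
Proof.
move=> k0 l0 hA hA' hA'' K0 mulA B1 B2.
have N1 := comp_norm_ge0 hA B1; split.
  have [F [T [Q1 [Q2 [[CT _] [AQ1 _] [AQ2 _] -> ->]]]]] :=
    comp_common_factor k0 l0 hA hA' B1 (ltr_pwDr ltr01 (lexx _))
      B2 (ltr_pwDr ltr01 (lexx _)).
  exact: (comp_set CT (mulA _ _ _ AQ1 AQ2).1).
apply: le_mul_of_gt => [|r2 Pr2]; first exact: mulr_ge0.
have r20 : 0 <= r2 by rewrite (le_trans _ (ltW Pr2))// (comp_norm_ge0 hA').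
rewrite mulrAC; apply: le_mul_of_gt => [|r1 Pr1]; first exact: mulr_ge0.
have [F [T [Q1 [Q2 [[CT T1] [AQ1 Qr1] [AQ2 Qr2] -> ->]]]]] :=
  comp_common_factor k0 l0 hA hA' B1 Pr1 B2 Pr2.
have [AQ Qle] := mulA _ _ _ AQ1 AQ2.
apply: (le_trans (comp_norm_le1 hA'' CT T1 AQ)); apply: (le_trans Qle).
rewrite -!mulrA ler_wpM2l// [leRHS]mulrC.
by rewrite ler_pM ?(pi_norm_ge0 hA) ?(pi_norm_ge0 hA')// ltW.
Qed.

End ClosedOpIdeal.

Arguments comp_set {R C k A E F T Q}.

(** * Multiplicative sequences *)

(** With P = Q o T and T of norm at most 1, P_a is the composition of Q_(T a)
with T, and the norm of T a is at most that of a. *)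
Lemma comp_poly_at (R : realType) (C : op_ideal R) (k : nat)
    (A A' : poly_ideal R) (c : R) (E : banach R) P a :
  closed_op_ideal C -> (0 < k)%N ->
  banach_poly_ideal k A -> banach_poly_ideal k.+1 A' -> 0 <= c ->
  (forall (F : banach R) Q b, pi_set A' F Q ->
     pi_set A F (poly_at k Q b) /\
     pi_norm A (poly_at k Q b) <= c * pi_norm A' Q * rnorm b) ->
  pi_set (comp_ideal k.+1 A' C) E P ->
  pi_set (comp_ideal k A C) E (poly_at k P a) /\
  pi_norm (comp_ideal k A C) (poly_at k P a) <=
    c * pi_norm (comp_ideal k.+1 A' C) P * rnorm a.
Proof.
move=> hC k0 hA hA' c0 coh BP; split.
  have [F [T [Q [CT AQ ->]]]] := BP.
  rewrite (poly_at_comp _ (oi_bounded hC CT) (bpi_poly hA' AQ)).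
  exact: (comp_set CT (coh _ _ _ AQ).1).
rewrite mulrAC; apply: le_mul_of_gt => [|r Pr].
  by rewrite mulr_ge0 ?rnorm_ge0.
have [F [T [Q [CT T1 AQ /ltW Qr ->]]]] := comp_factor hC (ltn0Sn k) hA' BP Pr.
have bT := oi_bounded hC CT.
rewrite (poly_at_comp _ bT (bpi_poly hA' AQ)).
have [AQa Qle] := coh F Q (T a) AQ.
apply: (le_trans (comp_norm_le1 hC hA CT T1 AQa)); apply: (le_trans Qle).
rewrite [leRHS]mulrAC; apply: ler_pM; rewrite ?rnorm_ge0//.
- by rewrite mulr_ge0 ?(pi_norm_ge0 hA').
- by rewrite ler_wpM2l.
- apply: (le_trans (le_opnorm bT a)).
  by rewrite ler_piMl ?rnorm_ge0.
Qed.

Theorem corollary2p5 (R : realType) (A : nat -> poly_ideal R) (C : op_ideal R)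
    (hA : multiplicative A) (hC : closed_op_ideal C) :
  multiplicative (fun k => comp_ideal k (A k) C).
Proof.
have [[idA [c [d [c0 d0 coh]]]] [M mulA]] := hA.
split; last first.
  (* M may be negative; the absolute value makes the constant nonnegative. *)
  exists `|M| => k l k0 l0 E P Q BP BQ.
  apply: (comp_product hC k0 l0 (idA k k0) (idA l l0)) => //.
  - by apply: idA; rewrite addn_gt0 k0.
  - by rewrite exprn_ge0.
  - move=> F S T AS AT; have [AST STle] := mulA k l k0 l0 F S T AS AT.
    split=> //; apply: (le_trans STle).
    rewrite -!mulrA ler_wpM2r ?mulr_ge0 ?(pi_norm_ge0 (idA _ _))//.
    by rewrite -normrX ler_norm.
split; first by move=> k k0; apply: banach_comp_ideal => //; exact: idA.
exists c, d; split=> // E k k0; split.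
  move=> P a; apply: comp_poly_at => //; [exact: idA|exact: idA|exact: ltW|].
  by move=> F Q b; exact: (coh F k k0).1.
move=> P g BP bg.
(* The space A 1 consists of functionals, with a norm at least the operator
   norm, so the coherence bound for g * P is a product bound from degrees 1 and
   k to degree k + 1. It passes to the composition ideals, where every bounded
   functional g has norm at most its operator norm in degree 1. *)
have [one1 norm1] := bpi_one (idA 1%N isT).
have Cg := oi_functional hC bg.
have Bg : pi_set (comp_ideal 1 (A 1%N) C) E g by exact: (comp_set Cg one1).
have Ng : pi_norm (comp_ideal 1 (A 1%N) C) g <= opnorm g.
  have := comp_norm_le hC (idA 1%N isT) Cg one1.
  by rewrite norm1 mul1r expr1.
have [gP gPle] : pi_set (comp_ideal (1 + k) (A (1 + k)%N) C) E (g * P) /\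
    pi_norm (comp_ideal (1 + k) (A (1 + k)%N) C) (g * P) <=
    d * pi_norm (comp_ideal 1 (A 1%N) C) g * pi_norm (comp_ideal k (A k) C) P.
  apply: (comp_product hC _ k0 (idA 1%N isT) (idA k k0)) => //.
  - exact: idA.
  - exact: ltW.
  - move=> F Q1 Q2 AQ1 AQ2.
    have bQ1 := homog_poly1 (bpi_poly (idA 1%N isT) AQ1).
    have [AQ Qle] := (coh F k k0).2 Q2 Q1 AQ2 bQ1.
    split=> //; apply: (le_trans Qle).
    rewrite ler_wpM2r ?(pi_norm_ge0 (idA _ _))// (ler_wpM2l (ltW d0))//.
    apply: (opnorm_le bQ1); first exact: (pi_norm_ge0 (idA 1%N isT)).
    by move=> x; have := pi_eval_le (idA 1%N isT) x AQ1; rewrite expr1.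
split=> //; apply: (le_trans gPle).
rewrite ler_wpM2r ?(comp_norm_ge0 hC (idA k k0))//.
by rewrite (ler_wpM2l (ltW d0)).
Qed.
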